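(* Let $G$ be an embedded graph such that $G^{*\times}$ is orientable, and let $k\in\mathbb{N}$. Then $$P(G;-k)=(-1)^{f(G)}\sum_{\phi\in\mathcal{P}(G_m,k)}2^{\mathrm{tot}(\phi)}.$$
   Context: An embedded graph is a graph (loops and multiple edges allowed, not necessarily connected) cellularly embedded in a closed, possibly non-orientable, surface, i.e. each component of the complement (each face) is an open disc. Equivalently, it is a ribbon graph: a surface with boundary written as a union of vertex discs and edge discs (ribbons), each edge disc meeting the vertex discs in exactly two disjoint arcs. $f(G)$ is the number of boundary components of the ribbon graph (number of faces). An embedded graph is orientable if its surface is orientable. $G^*$ is the geometric dual of $G$. The partial Petrial $G^{\tau(A)}$, $A\subseteq E(G)$, is the ribbon graph obtained from $G$ by adding a half-twist to each edge in $A$, the Petrie dual is $G^{\times}=G^{\tau(E(G))}$, and $G^{*\times}=(G^* )^{\times}$. Penrose polynomial: $P(G;\lambda)=\sum_{A\subseteq E(G)}(-1)^{|A|}\lambda^{f(G^{\tau(A)})}$. Medial graph: $G_m$ is the 4-regular graph embedded in the same surface obtained by placing a vertex $v_e$ on each edge $e$ of $G$ and drawing the edges of $G_m$ by following the face boundaries of $G$. An isolated vertex of $G$ contributes a free loop (a circular edge with no vertex), which counts as an edge of $G_m$. The canonical checkerboard colouring of $G_m$ colours black the faces of $G_m$ containing a vertex of $G$ and colours white the remaining faces (which correspond to the faces of $G$). $k$-valuations: a $k$-valuation of $G_m$ is a map $\phi:E(G_m)\to\{1,\dots,k\}$ (free loops are coloured too) such that for every colour $i$ and every vertex $v$ the number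 of $i$-coloured half-edges at $v$ is even. At a vertex $v$ let $h_1,h_2,h_3,h_4$ be the incident half-edges in cyclic order, labelled so that the corners between $h_1,h_2$ and between $h_3,h_4$ are white and those between $h_2,h_3$ and between $h_4,h_1$ are black. The type of $\phi$ at $v$ is total if all four half-edges have the same colour; otherwise two distinct colours occur, each twice, and the type is white if $h_1,h_2$ agree and $h_3,h_4$ agree; black if $h_2,h_3$ agree and $h_4,h_1$ agree; crossing if $h_1,h_3$ agree and $h_2,h_4$ agree. $\mathrm{tot}(\phi)$ is the number of vertices of total type. $\mathcal{P}(G_m,k)$ is the set of $P$-permissible $k$-valuations, i.e. those for which every vertex is of white, crossing or total type. $\mathbb{N}$ denotes the positive integers. *)

(* Defs.v *)
From HB Require Import structures.
From mathcomp Require Import all_boot all_order all_algebra.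

Set Implicit Arguments.
Unset Strict Implicit.
Unset Printing Implicit Defensive.

Import GRing.Theory.

(* Embedded graphs (ribbon graphs), possibly non-orientable and disconnected,  *)
(* encoded by flags.  Each edge ribbon is a rectangle with four corners, its   *)
(* flags; a flag thus picks an edge, an end of that edge and a side of it.     *)
(*   tau0 x : same edge, same side, other end;                                 *)
(*   tau2 x : same edge, same end, other side;                                 *)
(*   tau1 x : the flag reached from x by following the boundary of the vertex  *)
(*            disc, away from the ribbon of x, up to the next ribbon end.      *)
(* Edges are the orbits of <tau0, tau2>, non-isolated vertices the orbits of   *)
(* <tau1, tau2>, and the boundary components of the ribbon graph that meet a   *)
(* ribbon are the orbits of <tau0, tau1>.  Isolated vertices carry no flag and *)
(* are listed apart; each is a disc, with one boundary component.              *)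
Record embGraph := EmbGraph {
  flag : finType;
  isolated : finType;
  tau0 : flag -> flag;
  tau1 : flag -> flag;
  tau2 : flag -> flag;
  tau0K : involutive tau0;
  tau1K : involutive tau1;
  tau2K : involutive tau2;
  tau0_neq : forall x, tau0 x != x;
  tau1_neq : forall x, tau1 x != x;
  tau2_neq : forall x, tau2 x != x;
  tau02C : forall x, tau0 (tau2 x) = tau2 (tau0 x);
  tau02_neq : forall x, tau0 (tau2 x) != x
}.

Section EmbeddedGraphs.
Variable G : embGraph.
Implicit Types x y : flag G.

Definition edgeOf x : {set flag G} :=
  [set x; tau0 x; tau2 x; tau0 (tau2 x)].

Definition edges : {set {set flag G}} := [set edgeOf x | x : flag G].

Lemma edgeOf_in x : edgeOf x \in edges.
Proof. exact: imset_f. Qed.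

Definition sameFace : rel (flag G) :=
  connect (fun x y => (y == tau0 x) || (y == tau1 x)).

Definition faceOf x : {set flag G} := [set y | sameFace x y].

Definition nfaces : nat := #|[set faceOf x | x : flag G]| + #|isolated G|.

(* The flags are the triangles of the barycentric subdivision of the surface,  *)
(* and the three involutions relate triangles sharing a side: an orientation   *)
(* of the surface is a choice of sign for every triangle that is reversed      *)
(* across every side.  Components that are isolated vertices are spheres.      *)
Definition orientable : Prop :=
  exists c : flag G -> bool,
    forall x, [/\ c (tau0 x) = ~~ c x, c (tau1 x) = ~~ c x
                & c (tau2 x) = ~~ c x].

Lemma edgeOf_tau0 x : edgeOf (tau0 x) = edgeOf x.
Proof.
apply/setP=> y; rewrite !inE -!tau02C !tau0K.
by case: (y == x); case: (y == tau0 x); case: (y == tau2 x); rewrite ?orbT ?orbF.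
Qed.

Lemma edgeOf_tau2 x : edgeOf (tau2 x) = edgeOf x.
Proof.
apply/setP=> y; rewrite !inE !tau2K.
case: (y == x); case: (y == tau0 x); case: (y == tau2 x);
  by rewrite ?orbT ?orbF.
Qed.

Definition dual : embGraph :=
  @EmbGraph (flag G) (isolated G) (@tau2 G) (@tau1 G) (@tau0 G)
    (@tau2K G) (@tau1K G) (@tau0K G) (@tau2_neq G) (@tau1_neq G) (@tau0_neq G)
    (fun x => esym (tau02C x))
    (fun x => eq_ind _ (fun z => z != x) (tau02_neq x) _ (tau02C x)).

(* A half-twist on an edge joins each side at one end to the opposite side at  *)
(* the other end.                                                              *)
Definition twist0 (A : {set {set flag G}}) x : flag G :=
  if edgeOf x \in A then tau0 (tau2 x) else tau0 x.

Lemma twist0K A : involutive (twist0 A).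
Proof.
move=> x; rewrite /twist0; case xA: (edgeOf x \in A).
  by rewrite edgeOf_tau0 edgeOf_tau2 xA -tau02C tau0K tau2K.
by rewrite edgeOf_tau0 xA tau0K.
Qed.

Lemma twist0_neq A x : twist0 A x != x.
Proof. by rewrite /twist0; case: ifP => _; rewrite ?tau02_neq ?tau0_neq. Qed.

Lemma twist02C A x : twist0 A (tau2 x) = tau2 (twist0 A x).
Proof. by rewrite /twist0 edgeOf_tau2; case: ifP => _; rewrite !tau02C. Qed.

Lemma twist02_neq A x : twist0 A (tau2 x) != x.
Proof.
rewrite /twist0 edgeOf_tau2; case: ifP => _; last exact: tau02_neq.
by rewrite tau2K tau0_neq.
Qed.

Definition partialPetrial (A : {set {set flag G}}) : embGraph :=
  @EmbGraph (flag G) (isolated G) (twist0 A) (@tau1 G) (@tau2 G)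
    (twist0K A) (@tau1K G) (@tau2K G)
    (twist0_neq A) (@tau1_neq G) (@tau2_neq G) (twist02C A) (twist02_neq A).

Definition petrieDual : embGraph := partialPetrial edges.

End EmbeddedGraphs.

Definition penrose (G : embGraph) : {poly int} :=
  (\sum_(A : {set {set flag G}} | A \subset edges G)
     (-1) ^+ #|A| *: 'X^(nfaces (partialPetrial A)))%R.

(* Checkerboard coloured embedded 4-regular graphs, free loops allowed (an     *)
(* edge has two half-edges, or none if it is a free loop).  For a half-edge h, *)
(* wnext h (resp. bnext h) is the half-edge at the same vertex that shares a   *)
(* white (resp. black) corner with h.  As an edge has a white and a black      *)
(* side, this determines the embedding.  By cvertexP the half-edges at v are   *)
(* h1, h2, h3, h4 in cyclic order, with the corners h1h2 and h3h4 white and    *)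
(* the corners h2h3 and h4h1 black.                                            *)
Record checkGraph := CheckGraph {
  half : finType;
  cvertex : finType;
  cedge : finType;
  hvertex : half -> cvertex;
  hedge : half -> cedge;
  wnext : half -> half;
  bnext : half -> half;
  wnextK : involutive wnext;
  bnextK : involutive bnext;
  cvertexP : forall v, exists h1 h2 h3 h4 : half,
    [/\ uniq [:: h1; h2; h3; h4],
        forall h, (hvertex h == v) = (h \in [:: h1; h2; h3; h4]),
        wnext h1 = h2 /\ wnext h3 = h4
      & bnext h2 = h3 /\ bnext h4 = h1];
  cedgeP : forall e, #|[set h | hedge h == e]| \in [:: 0; 2]
}.

Section Valuations.
Variables (M : checkGraph) (k : nat).
Implicit Types (phi : {ffun cedge M -> 'I_k}) (v : cvertex M) (h : half M).

Definition colour phi h : 'I_k := phi (hedge h).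

Definition is_valuation phi : bool :=
  [forall v : cvertex M, forall i : 'I_k,
     ~~ odd #|[set h | (hvertex h == v) && (colour phi h == i)]|].

Definition total_at phi v : bool :=
  [forall h : half M, forall h' : half M,
     (hvertex h == v) ==> (hvertex h' == v) ==> (colour phi h == colour phi h')].

Definition white_at phi v : bool :=
  ~~ total_at phi v &&
  [forall h : half M, (hvertex h == v) ==> (colour phi h == colour phi (wnext h))].

Definition crossing_at phi v : bool :=
  ~~ total_at phi v &&
  [forall h : half M,
     (hvertex h == v) ==> (colour phi h == colour phi (bnext (wnext h)))].

Definition tot phi : nat := #|[set v | total_at phi v]|.

Definition permissible : {set {ffun cedge M -> 'I_k}} :=
  [set phi | is_valuation phi &&
     [forall v : cvertex M,
        [|| white_at phi v, crossing_at phi v | total_at phi v]]].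

End Valuations.

(* The medial graph.  The half-edges of G_m at v_e are the flags of e: the one *)
(* given by x leaves v_e towards the end and along the side of e selected by   *)
(* x.  It runs along the corner from x to tau1 x, so the edges of G_m with a   *)
(* vertex are the orbits of tau1.  The half-edges x and tau0 x bound a corner  *)
(* lying in a face of G (white), x and tau2 x one lying around a vertex of G   *)
(* (black).  Isolated vertices give the free loops.                            *)
Section Medial.
Variable G : embGraph.
Implicit Types x : flag G.

Definition cornerOf x : {set flag G} := [set x; tau1 x].

Definition corners : {set {set flag G}} := [set cornerOf x | x : flag G].

Lemma cornerOf_in x : cornerOf x \in corners.
Proof. exact: imset_f. Qed.

Definition medialVertex : finType := {e : {set flag G} | e \in edges G}.

Definition medialEdge : finType :=
  ({c : {set flag G} | c \in corners} + isolated G)%type.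

Definition medialHVertex x : medialVertex :=
  exist _ (edgeOf x) (edgeOf_in x).

Definition medialHEdge x : medialEdge :=
  inl (exist _ (cornerOf x) (cornerOf_in x)).

Lemma medialVertexP (v : medialVertex) : exists x1 x2 x3 x4 : flag G,
  [/\ uniq [:: x1; x2; x3; x4],
      forall x, (medialHVertex x == v) = (x \in [:: x1; x2; x3; x4]),
      tau0 x1 = x2 /\ tau0 x3 = x4
    & tau2 x2 = x3 /\ tau2 x4 = x1].
Proof.
case: v => e eE; have [x _ def_e] := imsetP eE.
exists x, (tau0 x), (tau2 (tau0 x)), (tau2 x).
split; last 2 first.
- by rewrite tau02C tau0K.
- by rewrite tau2K.
- have tau02_neq' : tau0 x != tau2 x.
    by apply/eqP=> tau2x; have := tau02_neq x; rewrite -tau2x tau0K eqxx.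
  have inj0 := can_inj (@tau0K G).
  rewrite /= !inE !negb_or -!tau02C (inj_eq inj0) tau02_neq' tau0_neq.
  by rewrite ![x == _]eq_sym tau0_neq tau02_neq tau2_neq.
- move=> y; rewrite -val_eqE /= def_e; apply/eqP/idP.
    move=> /setP/(_ y); rewrite !inE eqxx /= -tau02C => /esym.
    by case/orP=> [/orP[/orP[]|]|] ->; rewrite ?orbT.
  rewrite !inE => /or4P[] /eqP-> //; by rewrite ?edgeOf_tau2 ?edgeOf_tau0 ?edgeOf_tau2.
Qed.

Lemma medialEdgeP (e : medialEdge) :
  #|[set x | medialHEdge x == e]| \in [:: 0; 2].
Proof.
case: e => [[c cC]|i]; last first.
  by rewrite (_ : [set _ | _] = set0) ?cards0 //; apply/setP=> x; rewrite !inE.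
have [x _ def_c] := imsetP cC.
rewrite (_ : [set _ | _] = [set x; tau1 x]).
  by rewrite cards2 eq_sym tau1_neq.
apply/setP=> y; rewrite !inE; apply/eqP/idP.
  move=> [] /=; rewrite def_c => /setP/(_ y).
  by rewrite !inE eqxx /= => /esym.
move=> yx; congr inl; apply: val_inj; rewrite /= def_c /cornerOf.
by case/orP: yx => /eqP-> //; rewrite tau1K setUC.
Qed.

Definition medial : checkGraph :=
  @CheckGraph (flag G) medialVertex medialEdge medialHVertex medialHEdge
    (@tau0 G) (@tau2 G) (@tau0K G) (@tau2K G) medialVertexP medialEdgeP.

End Medial.

(* Main.v *)
Require Import Defs.
From mathcomp Require Import all_boot all_order all_fingroup all_algebra.

Set Implicit Arguments.
Unset Strict Implicit.
Unset Printing Implicit Defensive.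

Import GRing.Theory.
Local Open Scope ring_scope.

(* For a positive integer k, k ^ f(G^tau(A)) counts the colourings of the      *)
(* medial edges that are constant along the faces of G^tau(A).  At v_e these   *)
(* faces join flags as a white smoothing if e is not in A and as a crossing if *)
(* e is in A, so a colouring is compatible with some A iff it is permissible,  *)
(* and then with exactly 2 ^ tot sets A, the total vertices being free.        *)
(* It remains to see that (-1) ^ (|A| + f(G^tau(A))) does not depend on A.     *)
(* Orientability of G*x gives a sign on flags that alternates along the faces  *)
(* of every partial Petrial and is preserved by tau2.  The faces of G^tau(A)   *)
(* are then the cycles of tau1 o tau0 on the positive flags, and twisting an   *)
(* edge composes this permutation with the transposition of its two positive   *)
(* flags, which changes the parity of the number of cycles.                    *)

(** At [-k] the term of [A] in the Penrose polynomial is (-1)^(|A| + f) k^f with f = f(G^tau(A)). By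
    [odd_nfaces_twist] its sign is (-1)^f(G) whatever [A] is; by [card_face_colouring] the power of
    [k] counts the colourings compatible with [A]. So P(G;-k) is (-1)^f(G) times the number of
    compatible pairs ([A], [phi]). Counted by [phi] instead, [face_colouring_permissible] and
    [card_face_colouring_sets] give 2^tot for each permissible [phi] and nothing for the others.
    Orientability of the Petrie dual of the dual enters only through the parity lemma. *)

Lemma card_imset_eq_ker (T U V : finType) (f : T -> U) (g : T -> V) :
  (forall x y, (f x == f y) = (g x == g y)) ->
  #|[set f x | x : T]| = #|[set g x | x : T]|.
Proof.
move=> fg; pose h (u : U) : {set V} := [set g x | x in [pred x | f x == u]].
have hf x : h (f x) = [set g x].
  apply/setP=> v; rewrite inE; apply/imsetP/eqP => [[y]|->].
    by rewrite inE fg => /eqP-> ->.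
  by exists x; rewrite ?inE.
rewrite -[RHS](card_imset _ (@set1_inj V)) -imset_comp.
rewrite -(@card_in_imset _ _ h) => [|u v].
  by rewrite -imset_comp (eq_imset _ (hf : h \o f =1 set1 \o g)).
case/imsetP=> x _ -> /imsetP[y _ ->]; rewrite !hf => /set1_inj/eqP.
by rewrite -fg => /eqP.
Qed.

Lemma even_card_involution (T : finType) (f : T -> T) (S : {set T}) :
  involutive f -> (forall x, f x != x) -> {in S, forall x, f x \in S} ->
  ~~ odd #|S|.
Proof.
move=> fK fx; have [n] := ubnP #|S|; elim: n S => // n IHn S leSn fS.
have [->|[x xS]] := set_0Vmem S; first by rewrite cards0.
rewrite (cardsD1 x) xS (cardsD1 (f x)) !inE fx fS //= negbK.
apply: IHn => [|y].
  by move: leSn; rewrite (cardsD1 x) xS (cardsD1 (f x)) !inE fx fS //= => /ltnW.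
rewrite !inE (inj_eq (can_inj fK)) (can2_eq fK fK) => /and3P[-> -> /fS->].
by [].
Qed.

(** A function constant on the fibres of [p] factors uniquely through the image of [p]. *)
Lemma card_ffun_fibres (E X : finType) (p : E -> X) (k : nat) :
  #|[set phi : {ffun E -> 'I_k} |
      [forall e, forall e', (p e == p e') ==> (phi e == phi e')]]|
  = (k ^ #|[set p e | e : E]|)%N.
Proof.
set F := [set p e | e : E]; pose FT : finType := {x | x \in F}.
have pF e : p e \in F by apply: imset_f.
pose q e : FT := exist _ (p e) (pF e).
have -> : (k ^ #|F|)%N = #|{ffun FT -> 'I_k}|.
  by rewrite card_ffun card_ord card_sig; congr (_ ^ _)%N; apply: eq_card => x.
have qsurj (u : FT) : {e | q e == u}.
  apply: sigW; case: u => u uF; have /imsetP[e _ ue] := uF; exists e.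
  by rewrite -val_eqE /= ue.
pose comp (psi : {ffun FT -> 'I_k}) := [ffun e => psi (q e)].
rewrite -cardsT -(card_imset setT (f := comp)); last first.
  move=> psi psi' /ffunP eqpsi; apply/ffunP=> u.
  by have [e /eqP<-] := qsurj u; have := eqpsi e; rewrite !ffunE.
apply: eq_card => phi; rewrite inE; apply/'forall_forallP/imsetP.
  move=> phiP; exists [ffun u => phi (sval (qsurj u))]; rewrite ?inE //.
  apply/ffunP=> e; rewrite !ffunE; apply/esym/eqP/(implyP (phiP _ _)).
  by case: (qsurj _) => e' /=; rewrite -val_eqE.
case=> psi _ -> e e'; apply/implyP=> /eqP pe; rewrite !ffunE.
by apply/eqP; congr (psi _); apply: val_inj.
Qed.

(** * Faces as cycles of a permutation *)

Section FacePermutation.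
Variables (G : embGraph) (c : flag G -> bool).
Hypothesis c0 : forall x, c (tau0 x) = ~~ c x.
Hypothesis c1 : forall x, c (tau1 x) = ~~ c x.
Implicit Types x y : flag G.

(** Both [tau0] and [tau1] reverse the sign [c], so their composite preserves it. Going round a face
    in one direction visits its positive flags; fixing the negative ones gives a permutation of all
    flags. *)
Definition face_step x := if c x then tau1 (tau0 x) else x.

Lemma face_step_inj : injective face_step.
Proof.
have cs x : c (face_step x) = c x.
  by rewrite /face_step; case: ifP => // cx; rewrite c1 c0 cx.
move=> x y sxy; have := cs y; rewrite -sxy cs => cxy.
move: sxy; rewrite /face_step cxy; case: ifP => // _.
by move/(can_inj (@tau1K G))/(can_inj (@tau0K G)).
Qed.

Definition face_perm : {perm flag G} := perm face_step_inj.

Definition positive_flag x := if c x then x else tau1 x.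

Lemma c_positive x : c (positive_flag x).
Proof. by rewrite /positive_flag; case: ifP => // cx; rewrite c1 cx. Qed.

Lemma sameFace_sym : symmetric (@sameFace G).
Proof.
apply: sym_connect_sym => x y.
by rewrite ![y == _]eq_sym (can2_eq (@tau0K G) (@tau0K G))
  (can2_eq (@tau1K G) (@tau1K G)).
Qed.

Lemma eq_faceOf x y : (faceOf x == faceOf y) = sameFace x y.
Proof.
apply/eqP/idP => [/setP/(_ y)|xy].
  by rewrite !inE => ->; apply: connect0.
by apply/setP=> z; rewrite !inE; apply: (same_connect sameFace_sym).
Qed.

Lemma sameFace_positive x : sameFace x (positive_flag x).
Proof.
rewrite /positive_flag; case: ifP => _; first exact: connect0.
by apply: connect1; rewrite eqxx orbT.
Qed.

(** A [tau1] move keeps the positive representative, while a [tau0] move shifts it one step forward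
    or back along [face_perm]. Conversely, a step of [face_perm] on a positive flag is a [tau0] move
    followed by a [tau1] move. *)
Lemma sameFace_porbit x y :
  sameFace x y =
  (porbit face_perm (positive_flag x) == porbit face_perm (positive_flag y)).
Proof.
apply/idP/idP.
  case/connectP=> p; elim: p x => [|z p IHp] x /=; first by move=> _ ->.
  case/andP=> xz /IHp{}IHp /IHp/eqP <-{IHp}.
  case/orP: xz => /eqP ->; rewrite /positive_flag ?c0 ?c1; case cx: (c x) => //=.
  - have -> : tau1 (tau0 x) = face_perm x by rewrite permE /face_step cx.
    by rewrite eq_porbit_mem porbit_sym (mem_porbit _ 1).
  - have -> : tau1 x = face_perm (tau0 x).
      by rewrite permE /face_step c0 cx /= tau0K.
    by rewrite eq_porbit_mem (mem_porbit _ 1).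
  - by rewrite tau1K.
have iterP z i : sameFace z (iter i face_perm z).
  elim: i => [|i IHi]; first exact: connect0.
  apply: connect_trans IHi _; rewrite iterS permE /face_step.
  case: ifP => _; last exact: connect0.
  apply: (connect_trans (y := tau0 (iter i face_perm z)));
    by apply: connect1; rewrite eqxx ?orbT.
rewrite eq_porbit_mem => /porbitP[i def_x].
apply: connect_trans (sameFace_positive x) _; rewrite -/(sameFace _ _) sameFace_sym.
apply: connect_trans (sameFace_positive y) _.
by rewrite def_x permX; apply: iterP.
Qed.

(** Each face is one cycle of positive flags, and each negative flag is a fixed point. *)
Lemma card_porbits_face_perm :
  #|porbits face_perm| =
    (#|[set faceOf x | x : flag G]| + #|[set x | ~~ c x]|)%N.
Proof.
have orbN x : ~~ c x -> porbit face_perm x = [set x].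
  move=> cx; have fx : face_perm x = x by rewrite permE /face_step (negPf cx).
  apply/setP=> y; rewrite inE; apply/porbitP/eqP => [[i ->]|->].
    by rewrite permX; elim: i => //= i ->.
  by exists 0%N; rewrite perm1.
have orbP x y : c x -> y \in porbit face_perm x -> c y.
  move=> cx /porbitP[i ->]; rewrite permX; elim: i => //= i.
  by rewrite permE /face_step => ci; rewrite ci c1 c0 ci.
rewrite (@card_imset_eq_ker _ _ _ _
  (fun x => porbit face_perm (positive_flag x))); last first.
  by move=> x y; rewrite eq_faceOf sameFace_porbit.
rewrite -[#|[set x | _]|](card_imset _ (@set1_inj _)) -cardsUI.
rewrite [X in (_ + X)%N](_ : _ = 0%N) ?addn0.
  apply: eq_card => O; rewrite inE; apply/imsetP/orP => [[x _ ->]|].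
    have [cx|cx] := boolP (c x).
      by left; apply/imsetP; exists x => //; rewrite /positive_flag cx.
    by right; rewrite orbN //; apply/imset_f; rewrite inE.
  case=> /imsetP[x cx ->]; first by exists (positive_flag x).
  by exists x => //; rewrite orbN //; rewrite inE in cx.
(* The two families are disjoint: the orbit of a positive flag contains only positive flags. *)
apply: eq_card0 => O; rewrite inE; apply/andP=> -[/imsetP[x _ ->]].
case/imsetP=> y; rewrite inE => cy oxy; case/negP: cy.
by apply: orbP (c_positive x) _; rewrite oxy inE.
Qed.

Lemma odd_nfaces :
  odd (nfaces G) =
    odd_perm face_perm (+) odd (#|flag G| + #|[set x | ~~ c x]| + #|isolated G|).
Proof.
rewrite /odd_perm card_porbits_face_perm /nfaces !oddD.
by do 4!case: (odd _).
Qed.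

End FacePermutation.

(** * Parity of the number of faces under half-twists *)

Section Twists.
Variables (G : embGraph) (c : flag G -> bool).
Hypothesis c0 : forall x, c (tau0 x) = ~~ c x.
Hypothesis c1 : forall x, c (tau1 x) = ~~ c x.
Hypothesis c2 : forall x, c (tau2 x) = c x.
Implicit Types (x y : flag G) (A : {set {set flag G}}).

Lemma c_twist0 A x : c (twist0 A x) = ~~ c x.
Proof. by rewrite /twist0; case: ifP; rewrite c0 ?c2. Qed.

Definition twist_perm A : {perm flag G} :=
  @face_perm (partialPetrial A) c (c_twist0 A) c1.

Lemma twist_permE A x :
  twist_perm A x = if c x then tau1 (twist0 A x) else x.
Proof. by rewrite permE. Qed.

(** After the half-twist, a side of the edge continues where the opposite side, at the same end,
    used to continue; on positive flags this first swaps [x] and [tau2 x]. *)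
Lemma twist_permU1 A x : c x -> edgeOf x \notin A ->
  twist_perm (edgeOf x |: A) = (tperm x (tau2 x) * twist_perm A)%g.
Proof.
move=> cx xA; apply/permP=> y; rewrite permM.
case: tpermP => [->|->|/eqP yx /eqP y2x].
- rewrite !twist_permE c2 cx /twist0 edgeOf_tau2 setU11.
  by rewrite (negPf xA).
- rewrite !twist_permE c2 cx /twist0 edgeOf_tau2 setU11.
  by rewrite (negPf xA) tau2K.
(* Another flag of the same edge would be [tau0 x] or [tau0 (tau2 x)], both negative; on other edges
   membership in [A] is unchanged. *)
rewrite !twist_permE; case: ifP => // cy; rewrite /twist0 in_setU1.
case: eqP => //= /setP/(_ y); rewrite !inE eqxx (negPf yx) (negPf y2x) /= orbF.
by case/esym/orP=> /eqP y0; move: cy; rewrite y0 c0 ?c2 cx.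
Qed.

Lemma odd_twist_perm A : A \subset edges G ->
  odd_perm (twist_perm A) = odd_perm (twist_perm set0) (+) odd #|A|.
Proof.
have [n] := ubnP #|A|; elim: n A => // n IHn A leAn sAE.
have [->|[e eA]] := set_0Vmem A; first by rewrite cards0 addbF.
have [x cx def_e] : exists2 x, c x & e = edgeOf x.
  have /imsetP[x _ def_e] := subsetP sAE e eA.
  have [cx|cx] := boolP (c x); first by exists x.
  by exists (tau0 x); rewrite ?c0 ?edgeOf_tau0.
rewrite (cardsD1 e A) eA /= -{1}(setD1K eA) def_e twist_permU1 //; last first.
  by rewrite !inE eqxx.
rewrite odd_permM odd_tperm eq_sym tau2_neq -def_e IHn.
- by rewrite add0n; case: (odd_perm _); case: (odd #|A :\ e|).
- by move: leAn; rewrite (cardsD1 e A) eA.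
- exact: subset_trans (subsetDl _ _) sAE.
Qed.

(** The flags, their signs and the isolated vertices are shared by [G] and its partial Petrials, so
    only the sign of the face permutation varies, by one transposition per twisted edge. *)
Lemma odd_nfaces_twist A : A \subset edges G ->
  odd (nfaces (partialPetrial A)) = odd (nfaces G) (+) odd #|A|.
Proof.
move=> sAE; rewrite (odd_nfaces (G := partialPetrial A) (c_twist0 A) c1).
rewrite (odd_nfaces c0 c1) -/(twist_perm A) odd_twist_perm //.
have -> : twist_perm set0 = face_perm c0 c1.
  by apply/permP=> x; rewrite !permE /face_step /= /twist0 inE.
by rewrite addbAC.
Qed.

End Twists.

(** * Colourings constant along the faces of a partial Petrial *)

Section Colourings.
Variables (G : embGraph) (k : nat).
Implicit Types (x y : flag G) (A : {set {set flag G}}).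
Implicit Types (phi : {ffun cedge (medial G) -> 'I_k}) (v : cvertex (medial G)).

(** Invariance under [tau1] is automatic, since [x] and [tau1 x] lie on the same medial edge. *)
Definition face_colouring A phi : bool :=
  [forall x : flag G, @colour (medial G) k phi x == colour phi (twist0 A x)].

Lemma colour_tau1 phi x :
  @colour (medial G) k phi (tau1 x) = @colour (medial G) k phi x.
Proof.
congr (phi (inl _)); apply: val_inj.
by rewrite /= /cornerOf tau1K setUC.
Qed.

(** Both flags of a corner lie in the same face, so the union is that face; it avoids choosing a
    representative. *)
Definition medial_face A (e : medialEdge G) : {set flag G} + isolated G :=
  match e with
  | inl C => inl (\bigcup_(x in sval C) faceOf (G := partialPetrial A) x)
  | inr i => inr i
  end.

Lemma medial_faceE A x :
  medial_face A (medialHEdge x) = inl (faceOf (G := partialPetrial A) x).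
Proof.
rewrite /medial_face /= /cornerOf bigcup_setU !big_set1; congr inl.
suff /eqP-> : @faceOf (partialPetrial A) (tau1 x) == @faceOf (partialPetrial A) x.
  by rewrite setUid.
by rewrite eq_faceOf; apply: connect1; rewrite /= tau1K eqxx orbT.
Qed.

Lemma medialEdge_cases (e : medialEdge G) :
  (exists x, e = medialHEdge x) \/ (exists i, e = inr i).
Proof.
case: e => [[C CP]|i]; [left|by right; exists i].
have /imsetP[x _ def_C] := CP; exists x; congr inl; exact: val_inj.
Qed.

Lemma card_medial_face A :
  #|[set medial_face A e | e : medialEdge G]| = nfaces (partialPetrial A).
Proof.
rewrite /nfaces -(card_imset _ (@inl_inj {set flag G} (isolated G))) -cardsT.
rewrite -(card_imset setT (@inr_inj {set flag G} _)) -cardsUI.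
rewrite [X in (_ + X)%N](_ : _ = 0%N) ?addn0.
  apply: eq_card => F; rewrite inE; apply/imsetP/orP.
    case=> e _ ->; case: (medialEdge_cases e) => [[x ->]|[i ->]]; [left|right].
      by rewrite medial_faceE; apply/imset_f/imset_f.
    exact: imset_f.
  case=> /imsetP[].
    by move=> _ /imsetP[x _ ->] ->; exists (@medialHEdge G x); rewrite ?medial_faceE.
  by move=> i _ ->; exists (inr i).
by apply: eq_card0 => F; rewrite inE; apply/andP=> -[/imsetP[? _ ->] /imsetP[]].
Qed.

Lemma card_face_colouring A :
  #|[set phi | face_colouring A phi]| = (k ^ nfaces (partialPetrial A))%N.
Proof.
rewrite -card_medial_face -card_ffun_fibres; apply: eq_card => phi; rewrite !inE.
apply/forallP/'forall_forallP => [phiA e e'|phiP x].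
  apply/implyP; case: (medialEdge_cases e) (medialEdge_cases e')
    => [[x ->]|[i ->]] [[y ->]|[j ->]]; rewrite ?medial_faceE //; last first.
    by move=> /eqP[->].
  rewrite (inj_eq (@inl_inj _ _)) (@eq_faceOf (partialPetrial A)) => /connectP[p].
  elim: p x => [|z p IHp] x /=; first by move=> _ ->.
  case/andP=> xz /IHp{}IHp /IHp/eqP <-.
  case/orP: xz => /eqP->; first exact: phiA.
  by rewrite eq_sym; apply/eqP/(@colour_tau1 phi).
have := phiP (medialHEdge x) (medialHEdge (twist0 A x)).
rewrite !medial_faceE (inj_eq (@inl_inj _ _)) (@eq_faceOf (partialPetrial A)).
by move/implyP; apply; apply: connect1; rewrite /= eqxx.
Qed.

(** * Vertex types and compatible sets of twisted edges *)

Lemma medialHVertex_tau0 x : medialHVertex (tau0 x) = medialHVertex x.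
Proof. by apply: val_inj; rewrite /= edgeOf_tau0. Qed.

Lemma medialHVertex_tau2 x : medialHVertex (tau2 x) = medialHVertex x.
Proof. by apply: val_inj; rewrite /= edgeOf_tau2. Qed.

Lemma total_atP phi v :
  reflect (forall x y, medialHVertex x = v -> medialHVertex y = v ->
             @colour (medial G) k phi x = @colour (medial G) k phi y)
          (total_at phi v).
Proof.
apply: (iffP 'forall_forallP) => phiv x y.
  by move=> xv yv; have /implyP/(_ (introT eqP xv)) := phiv x y;
    move/implyP/(_ (introT eqP yv))/eqP.
by apply/implyP=> /eqP xv; apply/implyP=> /eqP yv; apply/eqP/phiv.
Qed.

(** Adding the total case cancels the non-totality clause of [white_at], leaving plain invariance
    under [tau0]. *)
Lemma white_or_totalP phi v :
  reflect (forall x, medialHVertex x = v ->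
             @colour (medial G) k phi x = @colour (medial G) k phi (tau0 x))
          (white_at phi v || total_at phi v).
Proof.
rewrite /white_at orbC; have [tv|_] := boolP (total_at phi v) => /=.
  by constructor=> x xv; apply: (total_atP _ _ tv); rewrite ?medialHVertex_tau0.
apply: (iffP forallP) => phiv x.
  by move=> xv; have /implyP/(_ (introT eqP xv))/eqP := phiv x.
by apply/implyP=> /eqP xv; apply/eqP/phiv.
Qed.

Lemma crossing_or_totalP phi v :
  reflect (forall x, medialHVertex x = v ->
             @colour (medial G) k phi x =
             @colour (medial G) k phi (tau0 (tau2 x)))
          (crossing_at phi v || total_at phi v).
Proof.
rewrite /crossing_at orbC; have [tv|_] := boolP (total_at phi v) => /=.
  constructor=> x xv; apply: (total_atP _ _ tv) => //.
  by rewrite medialHVertex_tau0 medialHVertex_tau2.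
apply: (iffP forallP) => phiv x.
  by move=> xv; have /implyP/(_ (introT eqP xv))/eqP := phiv x; rewrite tau02C.
by apply/implyP=> /eqP xv; apply/eqP; rewrite phiv //= tau02C.
Qed.

(** The white and crossing pairings together connect all four half-edges, which would force the
    excluded total type. *)
Lemma white_crossing_disjoint phi v : white_at phi v -> ~~ crossing_at phi v.
Proof.
move=> wv; apply/negP=> cv; have := wv; rewrite /white_at => /andP[/negP[]].
have /white_or_totalP w : white_at phi v || total_at phi v by rewrite wv.
have /crossing_or_totalP cr : crossing_at phi v || total_at phi v by rewrite cv.
have [x0 _ v_x0] := imsetP (valP v).
have x0v : medialHVertex x0 = v by apply: val_inj.
suff mono y : medialHVertex y = v ->
    @colour (medial G) k phi y = @colour (medial G) k phi x0.
  by apply/total_atP=> x y xv yv; rewrite !mono.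
move/(congr1 val); rewrite /= v_x0 => /setP/(_ y); rewrite !inE eqxx /= => /esym.
case/orP=> [/orP[/orP[]|]|] /eqP-> //; first by rewrite -w.
  by rewrite w ?medialHVertex_tau2 // -cr.
by rewrite -cr.
Qed.

Lemma face_colouringE A phi :
  face_colouring A phi =
  [forall v, (if val v \in A then crossing_at phi v else white_at phi v)
             || total_at phi v].
Proof.
apply/forallP/forallP => [phiA v|phiP x].
  case: ifP => vA; [apply/crossing_or_totalP|apply/white_or_totalP] => x xv;
    by have /eqP := phiA x; rewrite /twist0 [edgeOf x](congr1 val xv) vA.
have /= := phiP (medialHVertex x); rewrite /twist0.
by case: ifP => _; [move/crossing_or_totalP|move/white_or_totalP] => ->.
Qed.

Lemma face_colouring_permissible A phi :
  face_colouring A phi -> phi \in permissible (medial G) k.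
Proof.
move=> phiA; rewrite inE; apply/andP; split; last first.
  apply/forallP=> v; move: phiA; rewrite face_colouringE => /forallP/(_ v).
  by case: ifP => _;
    move: (white_at phi v) (crossing_at phi v) (total_at phi v) => [] [] [].
apply/forallP=> v; apply/forallP=> i.
(* [twist0 A] pairs the half-edges of colour [i] at [v] without fixed points. *)
apply: (even_card_involution (@twist0K G A) (@twist0_neq G A)) => x.
rewrite !inE => /andP[xv xi]; have /eqP <- := forallP phiA x; rewrite xi andbT.
by rewrite /twist0; case: ifP => _;
  rewrite /= ?medialHVertex_tau0 ?medialHVertex_tau2.
Qed.

Definition edges_of_type (P : pred (cvertex (medial G))) : {set {set flag G}} :=
  [set val v | v in P].

Lemma mem_edges_of_type (P : pred (cvertex (medial G))) v :
  (val v \in edges_of_type P) = P v.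
Proof. by rewrite mem_imset //; exact: val_inj. Qed.

(* The admissible sets are those lying between the crossing edges and the      *)
(* crossing or total edges.                                                    *)
Lemma card_face_colouring_sets phi : phi \in permissible (medial G) k ->
  #|[set A : {set {set flag G}} | (A \subset edges G) && face_colouring A phi]|
  = (2 ^ tot phi)%N.
Proof.
rewrite inE => /andP[_ /forallP phiP].
pose C := edges_of_type (crossing_at phi); pose T := edges_of_type (total_at phi).
have edgesP e : e \in edges G -> exists v : cvertex (medial G), e = val v.
  by move=> eE; exists (exist _ e eE).
have sub_edges P : edges_of_type P \subset edges G.
  by apply/subsetP=> _ /imsetP[v _ ->]; apply: valP.
have CT0 e : e \in T -> e \notin C.
  case/imsetP=> v tv ->; rewrite mem_edges_of_type; apply/negP=> /andP[].
  by rewrite -[total_at phi v]/(v \in total_at phi) tv.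
have -> : tot phi = #|T|.
  rewrite card_imset; last exact: val_inj.
  by apply: eq_card => v; rewrite inE.
rewrite -card_powerset -(card_in_imset (f := fun B => C :|: B) (D := powerset T)); last first.
  move=> B B'; rewrite !inE => sBT sB'T /setP eqB; apply/setP=> e.
  have := eqB e; rewrite !inE; have [eT|eT] := boolP (e \in T).
    by rewrite (negPf (CT0 e eT)).
  by rewrite (contraNF (subsetP sBT e) eT) (contraNF (subsetP sB'T e) eT).
apply: eq_card => A; rewrite inE face_colouringE; apply/andP/imsetP.
  case=> sAE /forallP phiA.
  exists (A :&: T); first by rewrite inE subsetIr.
  apply/eqP; rewrite eqEsubset; apply/andP; split; apply/subsetP=> e.
    move=> eA; have [v def_e] := edgesP e (subsetP sAE e eA).
    by have := phiA v; rewrite -def_e eA !inE eA def_e !mem_edges_of_type.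
  rewrite !inE => /orP[|/andP[] //] => /imsetP[v cv ->].
  have := phiA v; case: ifP => // _ /orP[/white_crossing_disjoint|tv].
    by rewrite -[crossing_at phi v]/(v \in crossing_at phi) cv.
  by have /andP[/negP[]] := cv.
case=> B; rewrite inE => sBT ->; split.
  by rewrite subUset sub_edges (subset_trans sBT (sub_edges _)).
apply/forallP=> v; rewrite inE mem_edges_of_type.
have [|/negPf ncv] := boolP (crossing_at phi v) => //=; case: ifP => [/(subsetP sBT)|_].
  by rewrite mem_edges_of_type => ->; rewrite orbT.
by have := phiP v; rewrite ncv.
Qed.

End Colourings.

(** * Double counting of compatible pairs *)

Theorem mainTheorem4 (G : embGraph) (k : nat) :
  orientable (petrieDual (dual G)) ->
  (0 < k)%N ->
  (penrose G).[- (k%:Z)] =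
    (-1) ^+ nfaces G *
    \sum_(phi in permissible (medial G) k) 2%:Z ^+ tot phi.
Proof.
case=> c cP _.
have c1 (x : flag G) : c (tau1 x) = ~~ c x by have [] := cP x.
have c0 (x : flag G) : c (tau0 x) = ~~ c x by have [] := cP x.
have c2 (x : flag G) : c (tau2 x) = c x.
  (* In the Petrie dual of the dual, the edge involution is [tau2] composed with [tau0], so it sends
     [tau0 x] to [tau2 x]. *)
  have [+ _ _] := cP (tau0 x).
  rewrite /= /twist0 ifT; last exact: edgeOf_in.
  by rewrite /= tau0K c0 negbK.
have -> : \sum_(phi in permissible (medial G) k) 2%:Z ^+ tot phi =
    \sum_(A : {set {set flag G}} | A \subset edges G)
      \sum_(phi | face_colouring (k := k) A phi) 1.
  rewrite (exchange_big_dep (mem (permissible (medial G) k))) /=; last first.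
    by move=> A phi _; apply: face_colouring_permissible.
  apply: eq_bigr => phi phiP; rewrite sumr_const -[2%:Z]natz -natrX; congr _%:R.
  rewrite -(card_face_colouring_sets phiP).
  by apply: eq_card => A; rewrite !inE.
rewrite /penrose horner_sum mulr_sumr; apply: eq_bigr => A sAE.
rewrite hornerZ hornerXn [(- k%:Z) ^+ _]exprNn mulrA -exprD sumr_const.
have -> : #|face_colouring (k := k) A| = (k ^ nfaces (partialPetrial A))%N.
  by rewrite -card_face_colouring; apply: eq_card => phi; rewrite inE.
rewrite natrX natz; congr (_ * _).
(* The parity of |A| occurs twice, once explicitly and once in the face count, and cancels. *)
rewrite -[LHS]signr_odd -[RHS]signr_odd oddD (odd_nfaces_twist c0 c1 c2 sAE).
by rewrite addbC addbK.
Qed.
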